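(* Let $p_n$, $d_n$ and $b_n$ denote respectively the number of 2sip-walks, deque-walks and big-walks of length $2n$ (defined in the context). Then the limits \[\mu_p=\lim_{n\to\infty}\sqrt[n]{p_n},\qquad \mu_d=\lim_{n\to\infty}\sqrt[n]{d_n},\qquad \mu_b=\lim_{n\to\infty}\sqrt[n]{b_n}\] exist, are finite, and are all equal. Equivalently, the exponential growth rate of the number of permutations of length $n$ sortable by a deque equals that of permutations of length $n$ sortable by two stacks in parallel.
   Context: All walks are finite sequences of unit steps from $\{N,E,S,W\}=\{(0,1),(1,0),(0,-1),(-1,0)\}$ on $\mathbb{Z}^2$, starting at $(0,0)$. A walk is \emph{eager} if it contains no two consecutive steps $E$ then $S$, and no two consecutive steps $N$ then $W$. A \emph{QP-subloop} of a walk is a contiguous subsequence of steps starting and ending at the same point $(p,q)$ and visiting only points $(x,y)$ with $x\ge p$, $y\ge q$. A walk is \emph{standard} if every QP-subloop (of positive length) begins with an $N$ step. A walk is \emph{vertical-happy} if every step starting from a point on the line $x+y=0$ or $x+y=1$ is $N$ or $S$. A \emph{big-walk} is a standard eager walk staying in the half-plane $\{x+y\ge 0\}$ and ending at some point $(x,-x)$. A \emph{deque-walk} is a vertical-happy big-walk. A \emph{2sip-walk} is a standard eager walk staying in the quarter-plane $\{x\ge0,y\ge0\}$ and ending at $(0,0)$. Known fact (not part of the claim to prove, but explaining the equivalent formulation): 2sip-walks of length $2n$ are in bijection with permutations of length $n$ sortable by two stacks in parallel, and deque-walks of length $2n$ are in bijection with permutations of length $n$ sortable by a double-ended queue. *)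

(* Defs.v *)
From Stdlib Require Import Reals ZArith List Bool Arith.
Import ListNotations.

Inductive step : Set := stN | stE | stS | stW.

Definition step_eqb (a b : step) : bool :=
  match a, b with
  | stN, stN | stE, stE | stS, stS | stW, stW => true
  | _, _ => false
  end.

Definition delta (s : step) : Z * Z :=
  match s with
  | stN => (0, 1)%Z
  | stE => (1, 0)%Z
  | stS => (0, -1)%Z
  | stW => (-1, 0)%Z
  end.

Definition padd (p q : Z * Z) : Z * Z := (fst p + fst q, snd p + snd q)%Z.

Definition pos (w : list step) (k : nat) : Z * Z :=
  fold_left (fun p s => padd p (delta s)) (firstn k w) (0%Z, 0%Z).

Definition step_at (w : list step) (k : nat) : step := nth k w stN.

Definition all_lt (n : nat) (P : nat -> bool) : bool := forallb P (seq 0 n).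

Definition eager (w : list step) : bool :=
  all_lt (length w) (fun k =>
    if S k <? length w then
      negb (step_eqb (step_at w k) stE && step_eqb (step_at w (S k)) stS) &&
      negb (step_eqb (step_at w k) stN && step_eqb (step_at w (S k)) stW)
    else true).

Definition qp_subloop (w : list step) (i j : nat) : bool :=
  let p := pos w i in
  (i <? j) && (j <=? length w) &&
  (Z.eqb (fst (pos w j)) (fst p) && Z.eqb (snd (pos w j)) (snd p)) &&
  all_lt (S j) (fun k =>
    if i <=? k then (Z.leb (fst p) (fst (pos w k)) && Z.leb (snd p) (snd (pos w k)))
    else true).

Definition standard (w : list step) : bool :=
  all_lt (S (length w)) (fun i => all_lt (S (length w)) (fun j =>
    implb (qp_subloop w i j) (step_eqb (step_at w i) stN))).

Definition stays_in (P : Z * Z -> bool) (w : list step) : bool :=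
  all_lt (S (length w)) (fun k => P (pos w k)).

Definition endpoint (w : list step) : Z * Z := pos w (length w).

Definition big_walk (w : list step) : bool :=
  standard w && eager w &&
  stays_in (fun p => Z.leb 0 (fst p + snd p)) w &&
  Z.eqb (fst (endpoint w) + snd (endpoint w)) 0.

Definition vertical_happy (w : list step) : bool :=
  all_lt (length w) (fun k =>
    let p := pos w k in
    implb (Z.eqb (fst p + snd p) 0 || Z.eqb (fst p + snd p) 1)
          (step_eqb (step_at w k) stN || step_eqb (step_at w k) stS)).

Definition deque_walk (w : list step) : bool := vertical_happy w && big_walk w.

Definition twosip_walk (w : list step) : bool :=
  standard w && eager w &&
  stays_in (fun p => Z.leb 0 (fst p) && Z.leb 0 (snd p)) w &&
  (Z.eqb (fst (endpoint w)) 0 && Z.eqb (snd (endpoint w)) 0).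

Fixpoint all_walks (n : nat) : list (list step) :=
  match n with
  | O => [[]]
  | S m => concat (map (fun s => map (cons s) (all_walks m)) [stN; stE; stS; stW])
  end.

Definition count_walks (P : list step -> bool) (n : nat) : nat :=
  length (filter P (all_walks n)).

Definition p_n (n : nat) : nat := count_walks twosip_walk (2 * n).
Definition d_n (n : nat) : nat := count_walks deque_walk (2 * n).
Definition b_n (n : nat) : nat := count_walks big_walk (2 * n).

Definition nth_root (a : nat) (n : nat) : R := Rpower (INR a) (/ INR n).

(* Main.v *)
(** All three families are closed under concatenation, so their growth rates exist by Fekete's
    lemma.  Deque-walks and 2sip-walks are big-walks, and [w |-> NN w SS] turns a big-walk into
    a deque-walk, which settles the deque case.

    For 2sip-walks, flip (N <-> E, S <-> W) every step of a big-walk that lies in no QP-subloop.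
    The QP-subloops are unchanged, so this is an involution on big-walks; it sends the endpoint
    (x,-x) to (-x,x).  By pigeonhole over the endpoint, the number of big-walks of length 4n
    ending at the origin is at least (b_n / (4n+1))^2.  Concatenating k such walks gives a walk
    that stays in a bounded shift of the quarter-plane, and [N^M E^M w S^M W^M] makes it a
    2sip-walk at a cost independent of k. *)

From Stdlib Require Import Reals ZArith List Bool Arith Lia Lra Classical.
From Coquelicot Require Import Rcomplements.
Require Import Defs.
Import ListNotations.
Open Scope nat_scope.

(** * Coordinates along a walk and under concatenation *)

Definition X (w : list step) (k : nat) : Z := fst (pos w k).
Definition Y (w : list step) (k : nat) : Z := snd (pos w k).

Definition dx (s : step) : Z := fst (delta s).
Definition dy (s : step) : Z := snd (delta s).

Lemma X_0 w : X w 0 = 0%Z.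
Proof. reflexivity. Qed.

Lemma Y_0 w : Y w 0 = 0%Z.
Proof. reflexivity. Qed.

Lemma fold_steps_shift l p q :
  fold_left (fun p s => padd p (delta s)) l (padd p q)
  = padd p (fold_left (fun p s => padd p (delta s)) l q).
Proof.
  revert q; induction l as [|s l IH]; intro q; simpl; [reflexivity|].
  rewrite <- IH; f_equal; unfold padd; simpl; f_equal; lia.
Qed.

Lemma pos_cons s w k : pos (s :: w) (S k) = padd (delta s) (pos w k).
Proof.
  unfold pos; simpl.
  rewrite <- (fold_steps_shift (firstn k w) (delta s) (0, 0)%Z).
  f_equal; unfold padd; simpl; f_equal; lia.
Qed.

Lemma X_cons s w k : X (s :: w) (S k) = (dx s + X w k)%Z.
Proof. unfold X, dx; rewrite pos_cons; reflexivity. Qed.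

Lemma Y_cons s w k : Y (s :: w) (S k) = (dy s + Y w k)%Z.
Proof. unfold Y, dy; rewrite pos_cons; reflexivity. Qed.

Lemma X_app_l u v k : k <= length u -> X (u ++ v) k = X u k.
Proof.
  revert k; induction u as [|s u IH]; intros [|k] Hk; simpl in *; try reflexivity; try lia.
  rewrite !X_cons, IH; lia.
Qed.

Lemma Y_app_l u v k : k <= length u -> Y (u ++ v) k = Y u k.
Proof.
  revert k; induction u as [|s u IH]; intros [|k] Hk; simpl in *; try reflexivity; try lia.
  rewrite !Y_cons, IH; lia.
Qed.

Lemma X_app_r u v k : X (u ++ v) (length u + k) = (X u (length u) + X v k)%Z.
Proof.
  induction u as [|s u IH]; simpl; [reflexivity|].
  rewrite !X_cons, IH; lia.
Qed.

Lemma Y_app_r u v k : Y (u ++ v) (length u + k) = (Y u (length u) + Y v k)%Z.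
Proof.
  induction u as [|s u IH]; simpl; [reflexivity|].
  rewrite !Y_cons, IH; lia.
Qed.

Lemma X_S w k : k < length w -> X w (S k) = (X w k + dx (step_at w k))%Z.
Proof.
  revert k; induction w as [|s w IH]; intros [|k] Hk; simpl in *; try lia.
  - rewrite X_cons, !X_0; unfold step_at; simpl; lia.
  - rewrite !X_cons, IH by lia; unfold step_at; simpl; lia.
Qed.

Lemma Y_S w k : k < length w -> Y w (S k) = (Y w k + dy (step_at w k))%Z.
Proof.
  revert k; induction w as [|s w IH]; intros [|k] Hk; simpl in *; try lia.
  - rewrite Y_cons, !Y_0; unfold step_at; simpl; lia.
  - rewrite !Y_cons, IH by lia; unfold step_at; simpl; lia.
Qed.

Lemma X_bound w k : k <= length w -> (Z.abs (X w k) <= Z.of_nat k)%Z.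
Proof.
  induction k as [|k IH]; intro Hk; [rewrite X_0; lia|].
  rewrite X_S by lia; specialize (IH ltac:(lia)).
  destruct (step_at w k); unfold dx; simpl; lia.
Qed.

Lemma Y_bound w k : k <= length w -> (Z.abs (Y w k) <= Z.of_nat k)%Z.
Proof.
  induction k as [|k IH]; intro Hk; [rewrite Y_0; lia|].
  rewrite Y_S by lia; specialize (IH ltac:(lia)).
  destruct (step_at w k); unfold dy; simpl; lia.
Qed.

Lemma step_at_app_l u v k : k < length u -> step_at (u ++ v) k = step_at u k.
Proof. intro; unfold step_at; now apply app_nth1. Qed.

Lemma step_at_app_r u v k : step_at (u ++ v) (length u + k) = step_at v k.
Proof. unfold step_at; rewrite app_nth2 by lia; f_equal; lia. Qed.

(** * Quantified forms of the boolean walk predicates *)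

Definition qp (w : list step) (i j : nat) : Prop :=
  i < j <= length w /\ X w j = X w i /\ Y w j = Y w i /\
  forall k, i <= k <= j -> (X w i <= X w k /\ Y w i <= Y w k)%Z.

Definition allowed (a b : step) : Prop := ~ (a = stE /\ b = stS) /\ ~ (a = stN /\ b = stW).

Definition is_standard w : Prop := forall i j, qp w i j -> step_at w i = stN.
Definition is_eager w : Prop :=
  forall k, S k < length w -> allowed (step_at w k) (step_at w (S k)).
Definition in_half_plane w : Prop := forall k, k <= length w -> (0 <= X w k + Y w k)%Z.

Lemma all_ltP n P : all_lt n P = true <-> forall k, k < n -> P k = true.
Proof.
  unfold all_lt; rewrite forallb_forall; split; intros H k Hk.
  - apply H, in_seq; lia.
  - apply H; apply in_seq in Hk; lia.
Qed.

Lemma step_eqbP a b : step_eqb a b = true <-> a = b.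
Proof. destruct a, b; simpl; split; intro; try reflexivity; discriminate. Qed.

Lemma stays_inP P w : stays_in P w = true <-> forall k, k <= length w -> P (pos w k) = true.
Proof.
  unfold stays_in; rewrite all_ltP; split; intros H k Hk; apply H; lia.
Qed.

Lemma qp_subloopP w i j : qp_subloop w i j = true <-> qp w i j.
Proof.
  unfold qp_subloop, qp; fold (X w i) (Y w i) (X w j) (Y w j).
  rewrite !andb_true_iff, Nat.ltb_lt, Nat.leb_le, !Z.eqb_eq, all_ltP.
  split.
  - intros [[[Hij Hj] [HX HY]] H]; repeat split; try assumption;
      specialize (H k ltac:(lia)); rewrite (proj2 (Nat.leb_le i k)) in H by lia;
      apply andb_true_iff in H; rewrite !Z.leb_le in H; apply H.
  - intros [[Hij Hj] [HX [HY H]]]; repeat split; try assumption.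
    intros k Hk; destruct (Nat.leb_spec i k) as [Hik|]; [|reflexivity].
    rewrite andb_true_iff, !Z.leb_le; apply H; lia.
Qed.

Lemma standardP w : standard w = true <-> is_standard w.
Proof.
  unfold standard, is_standard; rewrite all_ltP; split.
  - intros H i j Hq; pose proof Hq as [Hij _].
    specialize (H i ltac:(lia)); rewrite all_ltP in H.
    specialize (H j ltac:(lia)); rewrite (proj2 (qp_subloopP w i j) Hq) in H.
    now apply step_eqbP.
  - intros H i _; rewrite all_ltP; intros j _.
    destruct (qp_subloop w i j) eqn:E; [|reflexivity].
    apply step_eqbP, (H i j), qp_subloopP, E.
Qed.

Lemma eagerP w : eager w = true <-> is_eager w.
Proof.
  unfold eager, is_eager; rewrite all_ltP.
  assert (R : forall a b, negb (step_eqb a stE && step_eqb b stS) &&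
                     negb (step_eqb a stN && step_eqb b stW) = true <-> allowed a b).
  { unfold allowed; intros [] []; simpl; intuition discriminate. }
  split; intros H k Hk.
  - specialize (H k ltac:(lia)); rewrite (proj2 (Nat.ltb_lt _ _) Hk) in H; now apply R.
  - destruct (Nat.ltb_spec (S k) (length w)); [apply R; auto|reflexivity].
Qed.

Definition is_big w : Prop :=
  is_standard w /\ is_eager w /\ in_half_plane w /\ (X w (length w) + Y w (length w) = 0)%Z.

Lemma big_walkP w : big_walk w = true <-> is_big w.
Proof.
  unfold big_walk, is_big, in_half_plane.
  rewrite !andb_true_iff, standardP, eagerP, stays_inP, Z.eqb_eq.
  setoid_rewrite Z.leb_le; unfold endpoint, X, Y; tauto.
Qed.

Definition is_happy w : Prop :=
  forall k, k < length w -> (X w k + Y w k = 0 \/ X w k + Y w k = 1)%Z ->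
  step_at w k = stN \/ step_at w k = stS.

Lemma deque_walkP w : deque_walk w = true <-> is_happy w /\ is_big w.
Proof.
  unfold deque_walk; rewrite andb_true_iff, big_walkP.
  enough (vertical_happy w = true <-> is_happy w) by tauto.
  unfold vertical_happy, is_happy; rewrite all_ltP.
  assert (R : forall k, implb (Z.eqb (fst (pos w k) + snd (pos w k)) 0
                        || Z.eqb (fst (pos w k) + snd (pos w k)) 1)
          (step_eqb (step_at w k) stN || step_eqb (step_at w k) stS) = true <->
     ((X w k + Y w k = 0 \/ X w k + Y w k = 1)%Z ->
  step_at w k = stN \/ step_at w k = stS)).
  { intro k; unfold X, Y.
    rewrite <- !Z.eqb_eq, <- !step_eqbP, <- !orb_true_iff.
    destruct (_ || _), (_ || _); simpl; intuition discriminate. }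
  split; intros H k Hk; apply R; auto.
Qed.

Definition above (a b : Z) w : Prop :=
  forall k, k <= length w -> (a <= X w k /\ b <= Y w k)%Z.

Lemma twosip_walkP w :
  twosip_walk w = true <->
  is_standard w /\ is_eager w /\ above 0 0 w /\
  X w (length w) = 0%Z /\ Y w (length w) = 0%Z.
Proof.
  unfold twosip_walk, above.
  rewrite !andb_true_iff, standardP, eagerP, stays_inP, !Z.eqb_eq.
  setoid_rewrite andb_true_iff; setoid_rewrite Z.leb_le.
  unfold endpoint, X, Y; simpl; tauto.
Qed.

(** * Concatenation *)

Lemma qp_app_l u v i j : j <= length u -> qp (u ++ v) i j -> qp u i j.
Proof.
  intros Hj [Hij [HX [HY H]]]; unfold qp.
  rewrite !X_app_l in HX by lia; rewrite !Y_app_l in HY by lia.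
  repeat split; try lia; specialize (H k ltac:(lia));
    rewrite !X_app_l, !Y_app_l in H by lia; lia.
Qed.

Lemma qp_app_r u v i j : qp (u ++ v) (length u + i) (length u + j) -> qp v i j.
Proof.
  intros [Hij [HX [HY H]]]; unfold qp; rewrite length_app in Hij.
  rewrite !X_app_r in HX by lia; rewrite !Y_app_r in HY by lia.
  repeat split; try lia; specialize (H (length u + k) ltac:(lia));
    rewrite !X_app_r, !Y_app_r in H by lia; lia.
Qed.

(* A loop straddling the junction must pass through its own base point there. *)
Lemma standard_app u v :
  is_standard u -> is_standard v ->
  (forall k, k <= length u -> (X u (length u) + Y u (length u) <= X u k + Y u k)%Z) ->
  is_standard (u ++ v).
Proof.
  intros Hu Hv Hm i j Hq.
  destruct (le_lt_dec j (length u)) as [Hj|Hj].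
  { assert (Hq' := qp_app_l _ _ _ _ Hj Hq).
    rewrite step_at_app_l by (destruct Hq'; lia); eauto. }
  destruct (le_lt_dec (length u) i) as [Hi|Hi].
  { replace i with (length u + (i - length u)) in * by lia.
    replace j with (length u + (j - length u)) in Hq by lia.
    rewrite step_at_app_r; apply qp_app_r in Hq; eauto. }
  rewrite step_at_app_l by lia; apply (Hu i (length u)).
  destruct Hq as [Hij [HX [HY H]]].
  assert (H0 := H (length u) ltac:(lia)).
  rewrite !X_app_l, !Y_app_l in H0 by lia.
  assert (Hm' := Hm i ltac:(lia)).
  repeat split; try lia; specialize (H k ltac:(lia));
    rewrite !X_app_l, !Y_app_l in H by lia; lia.
Qed.

Lemma eager_app u v :
  is_eager u -> is_eager v ->
  (0 < length u -> 0 < length v -> allowed (step_at u (length u - 1)) (step_at v 0)) ->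
  is_eager (u ++ v).
Proof.
  intros Hu Hv Hj k Hk; rewrite length_app in Hk.
  destruct (le_lt_dec (length u) k) as [H|H].
  { replace k with (length u + (k - length u)) by lia; rewrite plus_n_Sm, !step_at_app_r.
    apply Hv; lia. }
  rewrite step_at_app_l by lia.
  destruct (le_lt_dec (length u) (S k)) as [H'|H'].
  - replace (S k) with (length u + 0) by lia; rewrite step_at_app_r.
    replace k with (length u - 1) by lia; apply Hj; lia.
  - rewrite step_at_app_l by lia; apply Hu; lia.
Qed.

(** The walk starts on the line x + y = 0, and only [stN] and [stE] increase x + y. The empty walk
    is included because [step_at] defaults to [stN]. *)
Lemma big_first_step w : is_big w -> step_at w 0 = stN \/ step_at w 0 = stE.
Proof.
  intros (_ & _ & H & _); destruct w as [|s w]; [now left|].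
  specialize (H 1 ltac:(simpl; lia)); rewrite X_cons, Y_cons, X_0, Y_0 in H.
  unfold step_at; simpl; destruct s; cbn [dx dy delta fst snd] in H; auto; lia.
Qed.

Lemma big_last_step w : is_big w -> 0 < length w ->
  step_at w (length w - 1) = stS \/ step_at w (length w - 1) = stW.
Proof.
  intros (_ & _ & H & H0) Hl; specialize (H (length w - 1) ltac:(lia)).
  replace (length w) with (S (length w - 1)) in H0 by lia.
  rewrite X_S, Y_S in H0 by lia.
  destruct (step_at w (length w - 1)); cbn [dx dy delta fst snd] in H0; auto; lia.
Qed.

Lemma split_index {n k} : n <= k -> exists k', k = n + k'.
Proof. exists (k - n); lia. Qed.

Lemma big_app u v : is_big u -> is_big v -> is_big (u ++ v).
Proof.
  intros Hu Hv; pose proof Hu as (Hsu & Heu & Hhu & Hzu); pose proof Hv as (Hsv & Hev & Hhv & Hzv).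
  repeat apply conj.
  - apply standard_app; auto; intros k Hk; specialize (Hhu k Hk); lia.
  - apply eager_app; auto; intros _ _.
    (* A forbidden pair ends in [stS] or [stW], and [v] starts with neither. *)
    destruct (big_first_step _ Hv) as [-> | ->]; split; intros []; discriminate.
  - intros k Hk; rewrite length_app in Hk; destruct (le_lt_dec (length u) k) as [H|H].
    + destruct (split_index H) as [k' ->]; rewrite X_app_r, Y_app_r.
      specialize (Hhv k' ltac:(lia)); lia.
    + rewrite X_app_l, Y_app_l by lia; apply Hhu; lia.
  - rewrite length_app, X_app_r, Y_app_r; lia.
Qed.

Lemma happy_app u v :
  (X u (length u) + Y u (length u) = 0)%Z -> is_happy u -> is_happy v -> is_happy (u ++ v).
Proof.
  intros Hz Hu Hv k Hk; rewrite length_app in Hk; destruct (le_lt_dec (length u) k) as [H|H].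
  - destruct (split_index H) as [k' ->]; rewrite X_app_r, Y_app_r, step_at_app_r.
    intro; apply Hv; lia.
  - rewrite X_app_l, Y_app_l, step_at_app_l by lia; apply Hu; lia.
Qed.

Lemma above_app a b u v :
  above a b u -> above (a - X u (length u)) (b - Y u (length u)) v -> above a b (u ++ v).
Proof.
  intros Hu Hv k Hk; rewrite length_app in Hk; destruct (le_lt_dec (length u) k) as [H|H].
  - destruct (split_index H) as [k' ->]; rewrite X_app_r, Y_app_r.
    specialize (Hv k' ltac:(lia)); lia.
  - rewrite X_app_l, Y_app_l by lia; apply Hu; lia.
Qed.

(** The bound [M] survives concatenation because each factor returns to the origin, so one wrapping
    serves any number of concatenated loops. *)
Definition is_loop (M : nat) w : Prop :=
  is_big w /\ X w (length w) = 0%Z /\ above (- Z.of_nat M) (- Z.of_nat M) w.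

Lemma loop_app M u v : is_loop M u -> is_loop M v -> is_loop M (u ++ v).
Proof.
  intros (Hu & Hxu & Hqu) (Hv & Hxv & Hqv); pose proof Hu as (_ & _ & _ & Hz).
  split; [|split].
  - now apply big_app.
  - rewrite length_app, X_app_r; lia.
  - apply above_app; [exact Hqu|].
    replace (Y u (length u)) with 0%Z by lia; now rewrite Hxu, !Z.sub_0_r.
Qed.

Lemma twosip_is_big w : twosip_walk w = true -> is_big w.
Proof.
  rewrite twosip_walkP; intros (Hs & He & Hq & HX & HY); repeat apply conj; auto; try lia.
  intros k Hk; specialize (Hq k Hk); lia.
Qed.

Lemma twosip_app u v :
  twosip_walk u = true -> twosip_walk v = true -> twosip_walk (u ++ v) = true.
Proof.
  intros Hu Hv; destruct (big_app u v (twosip_is_big _ Hu) (twosip_is_big _ Hv)) as (Hs & He & _).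
  rewrite twosip_walkP in *; destruct Hu as (_ & _ & Hqu & Hxu & Hyu).
  destruct Hv as (_ & _ & Hqv & Hxv & Hyv).
  repeat apply conj; auto; try (rewrite length_app; rewrite ?X_app_r, ?Y_app_r; lia).
  apply above_app; [exact Hqu|now rewrite Hxu, Hyu].
Qed.

Lemma deque_app u v :
  deque_walk u = true -> deque_walk v = true -> deque_walk (u ++ v) = true.
Proof.
  rewrite !deque_walkP; intros [Hhu Hu] [Hhv Hv]; split; [|now apply big_app].
  apply happy_app; auto; apply Hu.
Qed.

(** * Wrapping a walk *)

Lemma qp_cons_S s w i j : qp (s :: w) (S i) (S j) -> qp w i j.
Proof. exact (qp_app_r [s] w i j). Qed.

Lemma standard_cons s w :
  is_standard w -> (forall j, qp (s :: w) 0 j -> s = stN) -> is_standard (s :: w).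
Proof.
  intros Hw Hs i j Hq; destruct i as [|i]; [exact (Hs j Hq)|].
  destruct j as [|j]; [destruct Hq; lia|].
  change (step_at w i = stN); apply (Hw i j), (qp_cons_S s), Hq.
Qed.

(** Any subloop created by prepending a step begins with that step, which here is the required
    [stN]. *)
Lemma standard_repeat_N m w : is_standard w -> is_standard (repeat stN m ++ w).
Proof.
  intro Hw; induction m as [|m IH]; [exact Hw|].
  simpl; apply standard_cons; auto.
Qed.

(** A step [stS] or [stW] leaves the quarter-plane at its starting point at once, so there are no
    QP-subloops at all. *)
Lemma standard_descending w :
  (forall k, k < length w -> step_at w k = stS \/ step_at w k = stW) -> is_standard w.
Proof.
  intros Hd i j [Hij [HX [HY H]]].
  specialize (H (S i) ltac:(lia)); rewrite X_S, Y_S in H by lia.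
  destruct (Hd i ltac:(lia)) as [E|E]; rewrite E in H; cbn [dx dy delta fst snd] in H; lia.
Qed.

(** No loop begins at a prepended [stE]: as long as [t] lasts, x + y stays above its value at the
    base point, and the [stS] right after [t] drops below the height of the base point. *)
Lemma standard_repeat_E m t r :
  in_half_plane t -> Y t (length t) = 0%Z ->
  is_standard (t ++ stS :: r) -> is_standard (repeat stE m ++ t ++ stS :: r).
Proof.
  intros Ht Hy Hs; induction m as [|m IH]; [exact Hs|].
  change (repeat stE (S m)) with (stE :: repeat stE m).
  rewrite app_assoc in *; set (t' := repeat stE m ++ t) in *.
  assert (Ht' : in_half_plane t' /\ Y t' (length t') = 0%Z).
  { clear - Ht Hy; subst t'; induction m as [|m [IH1 IH2]]; [auto|simpl; split].
    - intros [|k] Hk; [rewrite X_0, Y_0; lia|rewrite X_cons, Y_cons].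
      simpl in Hk; specialize (IH1 k ltac:(lia)); cbn [dx dy delta fst snd]; lia.
    - rewrite Y_cons, IH2; reflexivity. }
  destruct Ht' as [Hh Hy'].
  change ((stE :: repeat stE m) ++ t) with (stE :: t'); simpl.
  apply standard_cons; [exact IH|].
  intros [|j] [Hij [HX [HY H]]]; [lia|exfalso].
  rewrite X_0, Y_0, ?X_cons, ?Y_cons in *; simpl in Hij; rewrite length_app in Hij; simpl in Hij.
  destruct (le_lt_dec j (length t')) as [Hj|Hj].
  - rewrite X_app_l in HX by lia; rewrite Y_app_l in HY by lia.
    specialize (Hh j Hj); cbn [dx dy delta fst snd] in *; lia.
  (* This is the position just after the [stS], at height -1 relative to the base point. *)
  - specialize (H (S (length t' + 1)) ltac:(lia)).
    rewrite X_cons, Y_cons, Y_app_r, Y_cons, Y_0 in H.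
    cbn [dx dy delta fst snd] in H; lia.
Qed.

Lemma X_repeat s m k : k <= m -> X (repeat s m) k = (Z.of_nat k * dx s)%Z.
Proof.
  revert k; induction m as [|m IH]; intros [|k] Hk; try lia; try reflexivity.
  simpl repeat; rewrite X_cons, IH; lia.
Qed.

Lemma Y_repeat s m k : k <= m -> Y (repeat s m) k = (Z.of_nat k * dy s)%Z.
Proof.
  revert k; induction m as [|m IH]; intros [|k] Hk; try lia; try reflexivity.
  simpl repeat; rewrite Y_cons, IH; lia.
Qed.

Lemma step_at_repeat s m k : k < m -> step_at (repeat s m) k = s.
Proof. intro; unfold step_at; now apply nth_repeat_lt. Qed.

Lemma eager_repeat s m : is_eager (repeat s m).
Proof.
  intros k Hk; rewrite repeat_length in Hk; rewrite !step_at_repeat by lia.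
  split; intros []; congruence.
Qed.

(** The prefix [NN] lifts [w] to x + y >= 2, so only the four added vertical steps start on the
    lines x + y = 0 and x + y = 1. *)
Lemma big_wrap_deque w : is_big w -> deque_walk (repeat stN 2 ++ w ++ repeat stS 2) = true.
Proof.
  intro Hw; rewrite deque_walkP; pose proof Hw as (Hs & He & Hh & Hz).
  (* A table of x + y along the wrapped walk; vertical-happiness, the half-plane condition and the
     endpoint are read off from it. *)
  assert (Hp : forall k, k <= length w + 4 ->
    let W := repeat stN 2 ++ w ++ repeat stS 2 in
    k = 0 /\ step_at W k = stN /\ (X W k + Y W k = 0)%Z \/
    k = 1 /\ step_at W k = stN /\ (X W k + Y W k = 1)%Z \/
    k <= length w + 2 /\ (X W k + Y W k >= 2)%Z \/
    k = length w + 3 /\ step_at W k = stS /\ (X W k + Y W k = 1)%Z \/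
    k = length w + 4 /\ (X W k + Y W k = 0)%Z).
  { intros [|[|k]] Hk W; [left; auto|right; left; auto|].
    unfold W; simpl; rewrite !X_cons, !Y_cons; cbn [dx dy delta fst snd].
    unfold step_at; simpl nth; fold (step_at (w ++ [stS; stS]) k).
    destruct (le_lt_dec k (length w)) as [Hk'|Hk'].
    - rewrite X_app_l, Y_app_l by lia; specialize (Hh k Hk'); right; right; left; split; lia.
    - assert (E : k = length w + 1 \/ k = length w + 2) by lia.
      destruct E as [-> | ->]; rewrite X_app_r, Y_app_r, ?step_at_app_r;
        rewrite !X_cons, !Y_cons; cbn [dx dy delta fst snd].
      + right; right; right; left; repeat split; try lia.
        change (X [stS] 0) with 0%Z; change (Y [stS] 0) with 0%Z; lia.
      + right; right; right; right; split; [lia|].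
        change (X [] 0) with 0%Z; change (Y [] 0) with 0%Z; lia. }
  assert (Hl : length (repeat stN 2 ++ w ++ repeat stS 2) = length w + 4)
    by (rewrite !length_app, !repeat_length; lia).
  split; [|repeat apply conj].
  - intros k Hk; rewrite Hl in Hk; specialize (Hp k ltac:(lia)); simpl in *; intuition lia.
  - apply standard_repeat_N, standard_app; auto.
    + apply standard_descending; intros k Hk; rewrite repeat_length in Hk.
      rewrite step_at_repeat by lia; auto.
    + intros k Hk; specialize (Hh k Hk); lia.
  - apply eager_app; [apply eager_repeat|apply eager_app; [exact He|apply eager_repeat|]|].
    + intros H _; destruct (big_last_step _ Hw H) as [-> | ->]; split; intros []; discriminate.
    (* After [stN] only [stW] is forbidden; the next step is the first step of [w], or [stS] if [w]
       is empty. *)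
    + intros _ _; change (allowed stN (step_at (w ++ repeat stS 2) 0)).
      enough (step_at (w ++ repeat stS 2) 0 <> stW) by (split; intros []; congruence).
      destruct w as [|s w]; [discriminate|].
      change (step_at (s :: w) 0 <> stW).
      destruct (big_first_step _ Hw) as [-> | ->]; discriminate.
  - intros k Hk; rewrite Hl in Hk; specialize (Hp k Hk); simpl in *; intuition lia.
  - rewrite Hl; specialize (Hp (length w + 4) ltac:(lia)); simpl in *; intuition lia.
Qed.

(** The prefix moves the loop to start at (M, M), where the bound [M] keeps it in the quarter-plane.
    The order of the final blocks matters: going down by [stS] first is what prevents the prefixed
    [stE] steps from starting a loop. *)
Lemma loop_wrap_twosip M w : 0 < M -> 0 < length w -> is_loop M w ->
  twosip_walk (repeat stN M ++ repeat stE M ++ w ++ repeat stS M ++ repeat stW M) = true.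
Proof.
  intros HM Hl (Hw & Hx & Hq); pose proof Hw as (Hs & He & Hh & Hz).
  assert (Hy : Y w (length w) = 0%Z) by lia.
  assert (HX : forall s, X (repeat s M) (length (repeat s M)) = (Z.of_nat M * dx s)%Z)
    by (intro; rewrite repeat_length, X_repeat; lia).
  assert (HY : forall s, Y (repeat s M) (length (repeat s M)) = (Z.of_nat M * dy s)%Z)
    by (intro; rewrite repeat_length, Y_repeat; lia).
  assert (Hd : is_standard (repeat stS M ++ repeat stW M)).
  { apply standard_descending; intros k Hk; rewrite length_app, !repeat_length in Hk.
    destruct (le_lt_dec (length (repeat stS M)) k) as [H|H].
    - destruct (split_index H) as [k' ->]; rewrite step_at_app_r.
      rewrite repeat_length in Hk; rewrite step_at_repeat by lia; auto.
    - rewrite step_at_app_l by lia; rewrite repeat_length in H.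
      rewrite step_at_repeat by lia; auto. }
  assert (Hsw : is_standard (w ++ repeat stS M ++ repeat stW M)).
  { apply standard_app; auto; intros k Hk; specialize (Hh k Hk); lia. }
  rewrite twosip_walkP; repeat apply conj.
  (* Unfolding [M] exposes the [stS] right after [w] that [standard_repeat_E] relies on. *)
  - apply standard_repeat_N; destruct M as [|m]; [lia|].
    now apply (standard_repeat_E (S m) w (repeat stS m ++ repeat stW (S m))).
  - apply eager_app; [apply eager_repeat|apply eager_app; [apply eager_repeat|
      apply eager_app; [exact He|apply eager_app; [apply eager_repeat|apply eager_repeat|]|]|]|];
      intros _ _; rewrite ?repeat_length; rewrite ?step_at_repeat by lia.
    + split; intros []; discriminate.
    + destruct (big_last_step _ Hw Hl) as [-> | ->]; split; intros []; discriminate.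
    + rewrite step_at_app_l by lia.
      destruct (big_first_step _ Hw) as [-> | ->]; split; intros []; discriminate.
    + rewrite step_at_app_l by (rewrite repeat_length; lia); rewrite step_at_repeat by lia.
      split; intros []; discriminate.
  (* A straight block attains its smallest coordinates at one of its two ends. *)
  - assert (Hr : forall s a b, (a <= 0)%Z -> (b <= 0)%Z ->
        (a <= Z.of_nat M * dx s)%Z -> (b <= Z.of_nat M * dy s)%Z -> above a b (repeat s M)).
    { intros s a b Ha Hb Hax Hby k Hk; rewrite repeat_length in Hk.
      rewrite X_repeat, Y_repeat by lia; destruct s; cbn [dx dy delta fst snd] in *; lia. }
    repeat (apply above_app; rewrite ?HX, ?HY, ?Hx, ?Hy; cbn [dx dy delta fst snd]);
      try (apply Hr; cbn [dx dy delta fst snd]; lia).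
    intros k Hk; specialize (Hq k Hk); lia.
  - rewrite !length_app, !X_app_r, !HX, Hx; cbn [dx dy delta fst snd]; lia.
  - rewrite !length_app, !Y_app_r, !HY, Hy; cbn [dx dy delta fst snd]; lia.
Qed.

(** * Reflecting the steps outside all QP-subloops *)

Definition flip (s : step) : step :=
  match s with stN => stE | stE => stN | stS => stW | stW => stS end.

Definition covered (w : list step) (k : nat) : bool :=
  existsb (fun i => existsb (fun j => qp_subloop w i j && (i <=? k) && (k <? j))
    (seq 0 (S (length w)))) (seq 0 (S (length w))).

Definition reflect_uncovered (w : list step) : list step :=
  map (fun k => if covered w k then step_at w k else flip (step_at w k)) (seq 0 (length w)).

Lemma coveredP w k : covered w k = true <-> exists i j, qp w i j /\ i <= k < j.
Proof.
  unfold covered; rewrite existsb_exists; split.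
  - intros (i & _ & H); apply existsb_exists in H; destruct H as (j & _ & H).
    rewrite !andb_true_iff, qp_subloopP, Nat.leb_le, Nat.ltb_lt in H; exists i, j; tauto.
  - intros (i & j & H & Hk); exists i; pose proof H as [Hij _]; split; [apply in_seq; lia|].
    apply existsb_exists; exists j; split; [apply in_seq; lia|].
    rewrite !andb_true_iff, qp_subloopP, Nat.leb_le, Nat.ltb_lt; tauto.
Qed.

Lemma length_reflect w : length (reflect_uncovered w) = length w.
Proof. unfold reflect_uncovered; now rewrite length_map, length_seq. Qed.

Lemma step_at_reflect w k : k < length w ->
  step_at (reflect_uncovered w) k = if covered w k then step_at w k else flip (step_at w k).
Proof.
  intro Hk; unfold reflect_uncovered; set (f := fun k => _); unfold step_at at 1.
  rewrite (nth_indep _ stN (f 0)) by now rewrite length_map, length_seq.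
  now rewrite map_nth, seq_nth.
Qed.

Lemma dx_flip s : dx (flip s) = dy s.
Proof. now destruct s. Qed.

Lemma dy_flip s : dy (flip s) = dx s.
Proof. now destruct s. Qed.

(** A flip exchanges [dx] and [dy], so every step keeps its effect on x + y. *)
Lemma sum_reflect w k : k <= length w ->
  (X (reflect_uncovered w) k + Y (reflect_uncovered w) k = X w k + Y w k)%Z.
Proof.
  induction k as [|k IH]; intro Hk; [reflexivity|].
  rewrite !X_S, !Y_S, step_at_reflect by (rewrite ?length_reflect; lia).
  specialize (IH ltac:(lia)); destruct (covered w k); rewrite ?dx_flip, ?dy_flip; lia.
Qed.

Lemma displacement_covered w a b :
  b <= length w -> (forall k, a <= k < b -> covered w k = true) ->
  forall k, a <= k <= b ->
  (X (reflect_uncovered w) k - X (reflect_uncovered w) a = X w k - X w a)%Z /\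
  (Y (reflect_uncovered w) k - Y (reflect_uncovered w) a = Y w k - Y w a)%Z.
Proof.
  intros Hb Hc k; induction k as [|k IH]; intro Hk.
  { replace a with 0 by lia; lia. }
  destruct (Nat.eq_dec a (S k)) as [->|]; [lia|].
  rewrite !X_S, !Y_S, step_at_reflect by (rewrite ?length_reflect; lia).
  rewrite Hc by lia; specialize (IH ltac:(lia)); lia.
Qed.

Lemma qp_same_displacement w w' a b :
  length w' = length w ->
  (forall k, a <= k <= b -> (X w' k - X w' a = X w k - X w a)%Z /\
                            (Y w' k - Y w' a = Y w k - Y w a)%Z) ->
  qp w a b -> qp w' a b.
Proof.
  intros Hl H [Hab [HX [HY Hq]]]; repeat split; try lia;
    try (specialize (H b ltac:(lia)); lia); specialize (H k ltac:(lia));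
    specialize (Hq k ltac:(lia)); lia.
Qed.

Lemma qp_to_reflect w i j : qp w i j -> qp (reflect_uncovered w) i j.
Proof.
  intro H; apply (qp_same_displacement w); [apply length_reflect| |exact H].
  apply displacement_covered; [destruct H; lia|].
  intros k Hk; apply coveredP; eauto.
Qed.

Lemma qp_of_reflect_covered w a b :
  (forall k, a <= k < b -> covered w k = true) -> qp (reflect_uncovered w) a b -> qp w a b.
Proof.
  intros Hc H; apply (qp_same_displacement (reflect_uncovered w)); auto using length_reflect.
  pose proof H as [Hb _]; rewrite length_reflect in Hb.
  intros k Hk; destruct (displacement_covered w a b ltac:(lia) Hc k Hk); lia.
Qed.

(* Overlapping loops have the same base point. *)
Lemma qp_overlap w i j i' j' :
  qp w i j -> qp w i' j' -> i <= i' <= j -> j <= j' -> qp w i j'.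
Proof.
  intros [Hij [HX [HY H]]] [Hij' [HX' [HY' H']]] Hi Hj.
  assert (H1 := H i' ltac:(lia)); assert (H2 := H' j ltac:(lia)).
  repeat split; try lia; (destruct (le_lt_dec k j);
    [specialize (H k ltac:(lia))|specialize (H' k ltac:(lia))]; lia).
Qed.

(** Times at which the walk can be split without splitting a loop. The inequalities are strict so
    that an end of a loop may be uncut. *)
Definition uncut w a : Prop := forall i j, qp w i j -> ~ i < a < j.

(** A loop cut at [i] either encloses the given loop or merges with it by [qp_overlap]. Both cases
    yield a larger loop with an earlier left end, so induction on the left end applies. *)
Lemma qp_extend_left w i j : qp w i j ->
  exists i' j', qp w i' j' /\ i' <= i /\ j <= j' /\ uncut w i'.
Proof.
  revert j; induction i as [i IH] using lt_wf_ind; intros j H.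
  destruct (classic (uncut w i)) as [Hu|Hu]; [exists i, j; auto|].
  assert (Hc : exists i2 j2, qp w i2 j2 /\ i2 < i < j2).
  { apply NNPP; intro Hn; apply Hu; intros i2 j2 Hq Hi; apply Hn; eauto. }
  destruct Hc as (i2 & j2 & Hq & Hi).
  destruct (le_lt_dec j2 j) as [Hj|Hj].
  - destruct (IH i2 ltac:(lia) j) as (i' & j' & ? & ? & ? & ?).
    { apply (qp_overlap w i2 j2 i j); auto; lia. }
    exists i', j'; intuition lia.
  - destruct (IH i2 ltac:(lia) j2 Hq) as (i' & j' & ? & ? & ? & ?).
    exists i', j'; intuition lia.
Qed.

(** Between uncut times the walk consists of whole loops, with zero displacement before and after
    reflection, and of uncovered steps, for which the flip exchanges the coordinates. *)
Lemma displacement_uncut w a k : uncut w a -> uncut w k -> a <= k <= length w ->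
  (X w k - X w a = Y (reflect_uncovered w) k - Y (reflect_uncovered w) a)%Z /\
  (Y w k - Y w a = X (reflect_uncovered w) k - X (reflect_uncovered w) a)%Z.
Proof.
  intro Ha; induction k as [k IH] using lt_wf_ind; intros Hk Hak.
  destruct (Nat.eq_dec a k) as [->|Hne]; [lia|].
  destruct k as [|k]; [lia|]; destruct (covered w k) eqn:Hc.
  - apply coveredP in Hc; destruct Hc as (i0 & j0 & Hq0 & Hij0).
    destruct (qp_extend_left _ _ _ Hq0) as (i & j & Hq & Hi & Hj & Hu).
    (* The loop covers step [k] but may not contain [S k] strictly inside, so it ends there; the
       induction jumps back to its uncut start. *)
    assert (j = S k) by (specialize (Hk _ _ Hq); lia); subst j.
    assert (a <= i) by (specialize (Ha _ _ Hq); lia).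
    specialize (IH i ltac:(lia) Hu ltac:(lia)).
    pose proof (qp_to_reflect _ _ _ Hq) as [_ [HX' [HY' _]]].
    destruct Hq as [_ [HX [HY _]]]; lia.
  (* A loop with [k] strictly inside would cover step [k]. *)
  - assert (Hu : uncut w k).
    { intros i j Hq Hij; enough (covered w k = true) by congruence.
      apply coveredP; exists i, j; split; [exact Hq|lia]. }
    specialize (IH k ltac:(lia) Hu ltac:(lia)).
    rewrite !X_S, !Y_S, step_at_reflect, Hc, dx_flip, dy_flip
      by (rewrite ?length_reflect; lia); lia.
Qed.

(* A loop of the reflected walk whose ends do not cut loops of [w] is a mixture of whole loops
   of [w] and reflected steps; otherwise it can be enlarged until this is so. *)
Lemma qp_of_reflect w a b : qp (reflect_uncovered w) a b -> qp w a b.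
Proof.
  (* The measure is the number of steps outside the loop, which drops whenever the loop is
     enlarged. *)
  remember (length w - (b - a)) as m eqn:Hm; revert a b Hm.
  induction m as [m IH] using lt_wf_ind; intros a b Hm H.
  pose proof H as [Hab [HX [HY Hq]]]; rewrite length_reflect in Hab.
  (* Inside a loop of [w] every step is covered, hence unchanged by the reflection. *)
  assert (Hinside : forall i j, qp w i j -> i <= a -> b <= j -> qp w a b).
  { intros i j Hij Hi Hj; apply qp_of_reflect_covered; auto.
    intros k Hk; apply coveredP; exists i, j; split; [exact Hij|lia]. }
  destruct (classic (exists i j, qp w i j /\ i < a < j)) as [(i & j & Hij & Hi)|Ha].
  (* If the cutting loop stops before [b], its union with the given one is a loop of the reflected
     walk, by induction a loop of [w], and [Hinside] applies to it. *)
  { destruct (le_lt_dec b j) as [Hj|Hj]; [apply (Hinside i j); auto; lia|].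
    apply (Hinside i b); try lia; apply (IH (length w - (b - i))); try lia.
    apply (qp_overlap _ i j a b); auto using qp_to_reflect; lia. }
  destruct (classic (exists i j, qp w i j /\ i < b < j)) as [(i & j & Hij & Hi)|Hb].
  { destruct (le_lt_dec i a) as [Hj|Hj]; [apply (Hinside i j); auto; lia|].
    pose proof Hij as [Hjl _].
    apply (Hinside a j); try lia; apply (IH (length w - (j - a))); try lia.
    apply (qp_overlap _ a b i j); auto using qp_to_reflect; lia. }
  assert (Ua : uncut w a) by (intros i j Hij Hi; apply Ha; eauto).
  assert (Ub : uncut w b) by (intros i j Hij Hi; apply Hb; eauto).
  assert (Hpos : forall k, uncut w k -> a <= k <= b -> (X w a <= X w k /\ Y w a <= Y w k)%Z).
  { intros k Hk Hkab; specialize (Hq k Hkab).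
    pose proof (displacement_uncut w a k Ua Hk); lia. }
  repeat apply conj; try lia.
  1, 2: pose proof (displacement_uncut w a b Ua Ub); lia.
  (* A cut time lies in a loop of [w] with uncut left end in [a, b]; its point dominates the base
     point of that loop, to which [Hpos] applies. *)
  intros k Hk; destruct (classic (uncut w k)) as [Hu|Hu]; [auto|].
  assert (Hc : exists i j, qp w i j /\ i < k < j).
  { apply NNPP; intro Hn; apply Hu; intros i j Hij Hi; apply Hn; eauto. }
  destruct Hc as (i0 & j0 & Hij0 & Hk0).
  destruct (qp_extend_left _ _ _ Hij0) as (i & j & Hij & Hi & Hj & Hui).
  assert (a <= i) by (specialize (Ua _ _ Hij); specialize (Ua); lia).
  specialize (Hpos i Hui ltac:(lia)); destruct Hij as [_ [_ [_ Hij]]].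
  specialize (Hij k ltac:(lia)); lia.
Qed.

Lemma covered_reflect w k : covered (reflect_uncovered w) k = covered w k.
Proof.
  apply eq_true_iff_eq; rewrite !coveredP; split; intros (i & j & H & Hk);
    exists i, j; auto using qp_of_reflect, qp_to_reflect.
Qed.

Lemma reflect_involutive w : reflect_uncovered (reflect_uncovered w) = w.
Proof.
  apply (nth_ext _ _ stN stN); [now rewrite !length_reflect|].
  intros k Hk; rewrite !length_reflect in Hk.
  change (step_at (reflect_uncovered (reflect_uncovered w)) k = step_at w k).
  rewrite !step_at_reflect, covered_reflect by (rewrite ?length_reflect; lia).
  now destruct (covered w k), (step_at w k).
Qed.

Lemma qp_first_step w i j : qp w i j -> step_at w i = stN \/ step_at w i = stE.
Proof.
  intros [Hij [_ [_ H]]]; specialize (H (S i) ltac:(lia)); rewrite X_S, Y_S in H by lia.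
  destruct (step_at w i); cbn [dx dy delta fst snd] in H; auto; lia.
Qed.

Lemma qp_last_step w i j : qp w i (S j) -> step_at w j = stS \/ step_at w j = stW.
Proof.
  intros [Hij [HX [HY H]]]; specialize (H j ltac:(lia)); rewrite X_S in HX by lia.
  rewrite Y_S in HY by lia.
  destruct (step_at w j); cbn [dx dy delta fst snd] in *; auto; lia.
Qed.

(** Two covered steps are unchanged, and flipping two uncovered steps exchanges the two forbidden
    pairs. At a change of status the covered step ends a loop with [stS] or [stW], or begins one
    with [stN] or [stE], and neither fits its place in a forbidden pair. *)
Lemma eager_reflect w : is_eager w -> is_eager (reflect_uncovered w).
Proof.
  intros He k Hk; rewrite length_reflect in Hk; specialize (He k Hk).
  rewrite !step_at_reflect by lia.
  destruct (covered w k) eqn:Hc, (covered w (S k)) eqn:Hc'.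
  - exact He.
  - apply coveredP in Hc; destruct Hc as (i & j & Hq & Hij).
    assert (j = S k).
    { enough (~ S k < j) by lia; intro; enough (covered w (S k) = true) by congruence.
      apply coveredP; exists i, j; split; [exact Hq|lia]. }
    subst j; destruct (qp_last_step _ _ _ Hq) as [-> | ->]; split; intros []; discriminate.
  - apply coveredP in Hc'; destruct Hc' as (i & j & Hq & Hij).
    assert (i = S k).
    { enough (~ i <= k) by lia; intro; enough (covered w k = true) by congruence.
      apply coveredP; exists i, j; split; [exact Hq|lia]. }
    subst i; destruct (qp_first_step _ _ _ Hq) as [-> | ->]; split; intros []; discriminate.
  - destruct He as [He1 He2].
    destruct (step_at w k), (step_at w (S k)); split; intros []; simpl in *; try discriminate; auto.
Qed.

Lemma big_reflect w : is_big w -> is_big (reflect_uncovered w).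
Proof.
  intros (Hs & He & Hh & Hz); repeat apply conj.
  - intros i j H; apply qp_of_reflect in H; rewrite step_at_reflect by (destruct H; lia).
    (* The first step of a loop is covered, so the reflection keeps it. *)
    replace (covered w i) with true; [eauto|symmetry; apply coveredP].
    exists i, j; split; [exact H|destruct H; lia].
  - now apply eager_reflect.
  - intros k Hk; rewrite length_reflect in Hk; rewrite sum_reflect; auto.
  - rewrite length_reflect, sum_reflect; auto.
Qed.

Lemma X_end_reflect w : is_big w ->
  X (reflect_uncovered w) (length (reflect_uncovered w)) = (- X w (length w))%Z.
Proof.
  intros (_ & _ & _ & Hz); rewrite length_reflect.
  (* No index lies outside the walk, so both ends are uncut and the total displacement is
     mirrored. *)
  assert (H : uncut w 0) by (intros i j _; lia).
  assert (H' : uncut w (length w)) by (intros i j [Hj _]; lia).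
  pose proof (displacement_uncut w 0 (length w) H H' ltac:(lia)) as [_ E].
  rewrite Y_0, X_0 in E; lia.
Qed.

(** * Counting *)

Lemma in_all_walks n w : In w (all_walks n) <-> length w = n.
Proof.
  revert w; induction n as [|n IH]; intro w; cbn [all_walks].
  - simpl; split; [now intros [<-|[]]|intro; left; symmetry; now apply length_zero_iff_nil].
  - rewrite in_concat; setoid_rewrite in_map_iff; split.
    + intros (l & (s & <- & _) & Hw); apply in_map_iff in Hw.
      destruct Hw as (w' & <- & Hw'); apply IH in Hw'; simpl; lia.
    + destruct w as [|s w]; simpl; intro H; [discriminate|].
      exists (map (cons s) (all_walks n)); split.
      * exists s; split; [reflexivity|destruct s; simpl; auto].
      * apply in_map, IH; lia.
Qed.

Lemma NoDup_all_walks n : NoDup (all_walks n).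
Proof.
  induction n as [|n IH]; cbn [all_walks]; [repeat constructor; auto|].
  assert (H : forall l : list step, NoDup l ->
    NoDup (concat (map (fun s => map (cons s) (all_walks n)) l))).
  { induction 1 as [|s l Hs Hl IHl]; simpl; [constructor|].
    apply NoDup_app; [|exact IHl|].
    - apply NoDup_map_NoDup_ForallPairs; [intros u v _ _; congruence|exact IH].
    - intros w Hw Hw'; apply in_map_iff in Hw; destruct Hw as (u & <- & _).
      apply in_concat in Hw'; destruct Hw' as (l' & Hl' & Hw').
      apply in_map_iff in Hl'; destruct Hl' as (s' & <- & Hs').
      apply in_map_iff in Hw'; destruct Hw' as (u' & E & _); congruence. }
  apply H; repeat constructor; simpl; intuition discriminate.
Qed.

Lemma length_all_walks n : length (all_walks n) = 4 ^ n.
Proof.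
  induction n as [|n IH]; [reflexivity|].
  simpl; rewrite !length_app, !length_map, IH; simpl; lia.
Qed.

Lemma NoDup_counted P n : NoDup (filter P (all_walks n)).
Proof. apply NoDup_filter, NoDup_all_walks. Qed.

Lemma in_counted P n w : In w (filter P (all_walks n)) <-> length w = n /\ P w = true.
Proof. now rewrite filter_In, in_all_walks. Qed.

Lemma count_walks_injection (P Q : list step -> bool) (f : list step -> list step) n m :
  (forall w, length w = n -> P w = true -> length (f w) = m /\ Q (f w) = true) ->
  (forall u v, f u = f v -> u = v) ->
  count_walks P n <= count_walks Q m.
Proof.
  intros H Hf; unfold count_walks; rewrite <- (length_map f).
  apply NoDup_incl_length;
    [apply NoDup_map_NoDup_ForallPairs; [intros u v _ _; apply Hf|apply NoDup_counted]|].
  intros w Hw; apply in_map_iff in Hw; destruct Hw as (u & <- & Hu).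
  apply in_counted in Hu; apply in_counted; apply H; tauto.
Qed.

Lemma NoDup_list_prod {A B} (l : list A) (l' : list B) :
  NoDup l -> NoDup l' -> NoDup (list_prod l l').
Proof.
  intros Hl Hl'; induction Hl as [|a l Ha Hl IH]; simpl; [constructor|].
  apply NoDup_app; [|exact IH|].
  - apply NoDup_map_NoDup_ForallPairs; [intros b c _ _; congruence|exact Hl'].
  - intros p Hp Hp'; apply in_map_iff in Hp; destruct Hp as (b & <- & _).
    apply in_prod_iff in Hp'; tauto.
Qed.

(** The first factor has fixed length [n], so a concatenation determines both of its factors. *)
Lemma count_walks_app (P Q R : list step -> bool) n m :
  (forall u v, P u = true -> Q v = true -> R (u ++ v) = true) ->
  count_walks P n * count_walks Q m <= count_walks R (n + m).
Proof.
  intro H; unfold count_walks; rewrite <- length_prod, <- (length_map (fun p => fst p ++ snd p)).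
  apply NoDup_incl_length.
  - apply NoDup_map_NoDup_ForallPairs; [|apply NoDup_list_prod; apply NoDup_counted].
    intros [u v] [u' v'] Hp Hp' E; apply in_prod_iff in Hp, Hp'; simpl in E.
    rewrite !in_counted in *; apply app_eq_app in E.
    destruct E as (l & [[E1 E2]|[E1 E2]]); subst; rewrite length_app in *;
      assert (El : l = []) by (apply length_zero_iff_nil; lia); subst l;
      now rewrite app_nil_r.
  - intros w Hw; apply in_map_iff in Hw; destruct Hw as ([u v] & <- & Hu).
    apply in_prod_iff in Hu; rewrite !in_counted in *; simpl.
    rewrite length_app; split; [lia|apply H; tauto].
Qed.

Lemma filter_filter_andb {A} (f g : A -> bool) l :
  filter f (filter g l) = filter (fun a => g a && f a) l.
Proof.
  induction l as [|a l IH]; simpl; [reflexivity|].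
  destruct (g a); simpl; [destruct (f a)|]; now rewrite IH.
Qed.

Lemma pigeonhole {A} (f : A -> Z) (c : nat) (range : list Z) (l : list A) :
  (forall a, In a l -> In (f a) range) ->
  (forall r, length (filter (fun a => Z.eqb (f a) r) l) <= c) ->
  length l <= length range * c.
Proof.
  revert l; induction range as [|r range IH]; intros l Hl Hc.
  - destruct l as [|a l]; [simpl; lia|destruct (Hl a); now left].
  - rewrite <- (filter_length (fun a => Z.eqb (f a) r) l); simpl.
    apply Nat.add_le_mono; [apply Hc|apply IH].
    + intros a Ha; apply filter_In in Ha; destruct Ha as [Ha Hr].
      destruct (Hl a Ha) as [->|]; [rewrite Z.eqb_refl in Hr; discriminate|assumption].
    + intro r'; etransitivity; [|apply (Hc r')].
      rewrite filter_filter_andb, (filter_ext _ (fun a => Z.eqb (f a) r' && negb (Z.eqb (f a) r)))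
        by (intro; apply andb_comm).
      rewrite <- filter_filter_andb; apply filter_length_le.
Qed.

(** * Big-walks with prescribed endpoint, and loops *)

Definition big_at (x : Z) (w : list step) : bool := big_walk w && Z.eqb (fst (endpoint w)) x.

Lemma big_atP x w : big_at x w = true <-> is_big w /\ X w (length w) = x.
Proof. unfold big_at; now rewrite andb_true_iff, big_walkP, Z.eqb_eq. Qed.

Definition loop_walk (M : nat) (w : list step) : bool :=
  big_at 0 w && stays_in (fun p => Z.leb (- Z.of_nat M) (fst p) && Z.leb (- Z.of_nat M) (snd p)) w.

Lemma loop_walkP M w : loop_walk M w = true <-> is_loop M w.
Proof.
  unfold loop_walk, is_loop, above; rewrite andb_true_iff, big_atP, stays_inP.
  setoid_rewrite andb_true_iff; setoid_rewrite Z.leb_le; unfold X, Y; tauto.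
Qed.

Lemma count_big_at_opp x n : count_walks (big_at x) n <= count_walks (big_at (- x)) n.
Proof.
  apply (count_walks_injection _ _ reflect_uncovered).
  - intros w Hl; rewrite !big_atP; intros [Hw Hx]; rewrite length_reflect; split; [exact Hl|].
    split; [now apply big_reflect|].
    rewrite <- Hx, <- (X_end_reflect w Hw); now rewrite length_reflect.
  - intros u v E; rewrite <- (reflect_involutive u), E; apply reflect_involutive.
Qed.

(** Reflection supplies as many walks ending at (-x, x), and these bring a walk ending at (x, -x)
    back to the origin. The bound in [loop_walk] is then automatic, since a walk never strays
    further than its length. *)
Lemma count_big_at_square x n :
  count_walks (big_at x) n * count_walks (big_at x) n <= count_walks (loop_walk (n + n)) (n + n).
Proof.
  transitivity (count_walks (big_at x) n * count_walks (big_at (- x)) n).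
  { apply Nat.mul_le_mono_l, count_big_at_opp. }
  transitivity (count_walks (big_at 0) (n + n)).
  - apply count_walks_app; intros u v; rewrite !big_atP; intros [Hu Hx] [Hv Hx'].
    split; [now apply big_app|rewrite length_app, X_app_r; lia].
  - apply (count_walks_injection _ _ (fun w => w)); [|auto].
    intros w Hl; rewrite loop_walkP, big_atP; intros [Hw Hx]; repeat (split; [assumption|]).
    intros k Hk; pose proof (X_bound w k Hk); pose proof (Y_bound w k Hk); lia.
Qed.

Lemma b_n_square_le n :
  b_n n * b_n n <= (4 * n + 1) * (4 * n + 1) * count_walks (loop_walk (4 * n)) (2 * (2 * n)).
Proof.
  set (z := count_walks _ _).
  (* Every endpoint class has size at most [Nat.sqrt z] because its square is at most [z]. *)
  assert (H : b_n n <= (4 * n + 1) * Nat.sqrt z).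
  (* After 2n steps the abscissa is one of the 4n + 1 integers from -2n to 2n. *)
  { replace (4 * n + 1) with
      (length (map (fun k => Z.of_nat k - Z.of_nat (2 * n))%Z (seq 0 (4 * n + 1))))
      by now rewrite length_map, length_seq.
    apply (pigeonhole (fun w => fst (endpoint w))).
    - intros w Hw; apply in_counted in Hw; destruct Hw as [Hl _].
      pose proof (X_bound w (length w) (le_n _)) as Hb.
      change (fst (endpoint w)) with (X w (length w)); apply in_map_iff.
      exists (Z.to_nat (X w (length w) + Z.of_nat (2 * n))); split; [lia|apply in_seq; lia].
    - intro x; apply Nat.sqrt_le_square.
      rewrite filter_filter_andb; subst z.
      replace (4 * n) with (2 * n + 2 * n) by lia.
      replace (2 * (2 * n)) with (2 * n + 2 * n) by lia.
      apply (count_big_at_square x). }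
  pose proof (Nat.sqrt_specif z) as [Hz _].
  etransitivity; [apply (Nat.mul_le_mono _ _ _ _ H H)|nia].
Qed.

Lemma loop_count_mul M n m :
  count_walks (loop_walk M) n * count_walks (loop_walk M) m <= count_walks (loop_walk M) (n + m).
Proof.
  apply count_walks_app; intros u v; rewrite !loop_walkP; apply loop_app.
Qed.

Lemma loop_nil M : is_loop M [].
Proof.
  split; [now apply big_walkP|split; [reflexivity|]].
  intros k _; replace (X [] k) with 0%Z by now destruct k.
  replace (Y [] k) with 0%Z by (now destruct k); lia.
Qed.

Lemma loop_count_pow M n k :
  count_walks (loop_walk M) n ^ k <= count_walks (loop_walk M) (k * n).
Proof.
  induction k as [|k IH]; [|simpl; etransitivity; [|apply loop_count_mul]].
  (* For [k = 0] the claim is that the empty walk is a loop. *)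
  { unfold count_walks; simpl; now rewrite (proj2 (loop_walkP M []) (loop_nil M)). }
  now apply Nat.mul_le_mono_l.
Qed.

Lemma loop_count_le_p M n : 0 < M -> 0 < n ->
  count_walks (loop_walk M) (2 * n) <= p_n (n + 2 * M).
Proof.
  intros HM Hn.
  apply (count_walks_injection _ _
    (fun w => repeat stN M ++ repeat stE M ++ w ++ repeat stS M ++ repeat stW M)).
  - intros w Hl; rewrite loop_walkP; intro Hw; rewrite !length_app, !repeat_length; split; [lia|].
    apply loop_wrap_twosip; auto; lia.
  - intros u v E; do 2 apply app_inv_head in E; now apply app_inv_tail in E.
Qed.

(** * Comparison and supermultiplicativity of the three counts *)

Lemma p_le_b n : p_n n <= b_n n.
Proof.
  apply (count_walks_injection _ _ (fun w => w)); [|auto].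
  intros w Hl Hw; split; [exact Hl|now apply big_walkP, twosip_is_big].
Qed.

Lemma d_le_b n : d_n n <= b_n n.
Proof.
  apply (count_walks_injection _ _ (fun w => w)); [|auto].
  intros w Hl Hw; split; [exact Hl|now apply andb_true_iff in Hw].
Qed.

Lemma b_le_d n : b_n n <= d_n (n + 2).
Proof.
  apply (count_walks_injection _ _ (fun w => repeat stN 2 ++ w ++ repeat stS 2)).
  - intros w Hl Hw; rewrite !length_app, !repeat_length; split; [lia|].
    now apply big_wrap_deque, big_walkP.
  - intros u v E; apply app_inv_head in E; now apply app_inv_tail in E.
Qed.

Lemma p_mul n m : p_n n * p_n m <= p_n (n + m).
Proof.
  unfold p_n; rewrite Nat.mul_add_distr_l; apply count_walks_app; exact twosip_app.
Qed.

Lemma d_mul n m : d_n n * d_n m <= d_n (n + m).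
Proof.
  unfold d_n; rewrite Nat.mul_add_distr_l; apply count_walks_app; exact deque_app.
Qed.

Lemma b_mul n m : b_n n * b_n m <= b_n (n + m).
Proof.
  unfold b_n; rewrite Nat.mul_add_distr_l; apply count_walks_app.
  intros u v; rewrite !big_walkP; apply big_app.
Qed.

Lemma pos_of_mul (a : nat -> nat) : 0 < a 0 -> 0 < a 1 ->
  (forall n m, a n * a m <= a (n + m)) -> forall n, 0 < a n.
Proof.
  intros H0 H1 Ha n; induction n as [|n IH]; [exact H0|].
  specialize (Ha 1 n); simpl in Ha; nia.
Qed.

Lemma p_pos n : 0 < p_n n.
Proof. apply (pos_of_mul p_n); [vm_compute; lia..|exact p_mul]. Qed.

Lemma d_pos n : 0 < d_n n.
Proof. apply (pos_of_mul d_n); [vm_compute; lia..|exact d_mul]. Qed.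

Lemma b_pos n : 0 < b_n n.
Proof. pose proof (p_pos n); pose proof (p_le_b n); lia. Qed.

Lemma b_le_pow n : b_n n <= 16 ^ n.
Proof.
  change 16 with (4 ^ 2); rewrite <- Nat.pow_mul_r, <- length_all_walks.
  apply filter_length_le.
Qed.

(** * Growth rates *)

Open Scope R_scope.

Lemma superadditive_mul (f : nat -> R) m : 0 <= f 0%nat ->
  (forall n k, f n + f k <= f (n + k)%nat) ->
  forall q, INR q * f m <= f (q * m)%nat.
Proof.
  intros H0 Hf q; induction q as [|q IH]; [simpl; lra|].
  rewrite S_INR; simpl; specialize (Hf m (q * m)%nat); lra.
Qed.

(** The limit is the supremum of [f n / INR n] over positive [n]; the second conclusion records that
    every term lies below it. *)
Lemma fekete (f : nat -> R) (C : R) :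
  (forall n, 0 <= f n) -> (forall n, f n <= C * INR n) ->
  (forall n k, f n + f k <= f (n + k)%nat) ->
  exists l, Un_cv (fun n => f n / INR n) l /\ forall n, f n <= l * INR n.
Proof.
  intros H0 HC Hf.
  set (E := fun r => exists n, (0 < n)%nat /\ r = f n / INR n).
  assert (HE : bound E).
  { exists C; intros r (n & Hn & ->); apply lt_0_INR in Hn.
    apply Rle_div_l; [exact Hn|apply HC]. }
  destruct (completeness E HE) as [l [Hub Hlub]].
  { exists (f 1%nat / INR 1); exists 1%nat; auto. }
  exists l; split.
  - intros eps Heps.
    assert (Hm : exists m, (0 < m)%nat /\ l - eps / 2 < f m / INR m).
    { apply NNPP; intro Hn; enough (l <= l - eps / 2) by lra.
      apply Hlub; intros r (m & Hm & ->); apply Rnot_lt_le; intro; apply Hn; eauto. }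
    destruct Hm as (m & Hm & Hlm); pose proof (lt_0_INR m Hm) as HmR.
    (* Beyond this [N] the loss [f m / INR n] from the incomplete last block of length [m] is below
       [eps / 2]. *)
    destruct (INR_unbounded (2 * f m / eps)) as [N HN].
    exists (S N); intros n Hn; pose proof (lt_0_INR n ltac:(lia)) as HnR.
    assert (Hup : f n / INR n <= l) by (apply Hub; exists n; split; [lia|reflexivity]).
    unfold Rdist; rewrite Rabs_left1 by lra.
    assert (Hq : INR n - INR m <= INR (n / m) * INR m).
    { pose proof (Nat.div_mod n m ltac:(lia)) as D.
      pose proof (Nat.mod_upper_bound n m ltac:(lia)) as U.
      rewrite <- mult_INR, Rle_minus_l, <- plus_INR; apply le_INR; nia. }
    assert (Hfn : INR (n / m) * f m <= f n).
    { etransitivity; [apply superadditive_mul; auto|].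
      pose proof (Hf (n / m * m)%nat (n mod m)%nat) as D; specialize (H0 (n mod m)%nat).
      replace (n / m * m + n mod m)%nat with n in D; [lra|].
      pose proof (Nat.div_mod n m ltac:(lia)); lia. }
    assert (Hc : (INR n - INR m) * (f m / INR m) <= f n).
    { etransitivity; [|exact Hfn].
      replace (INR (n / m) * f m) with (INR (n / m) * INR m * (f m / INR m)) by (field; lra).
      apply Rmult_le_compat_r; [|exact Hq].
      apply Rdiv_le_0_compat; auto. }
    assert (Hlast : f m / INR m - f m / INR n <= f n / INR n).
    { apply Rle_div_r; [exact HnR|].
      replace ((f m / INR m - f m / INR n) * INR n) with ((INR n - INR m) * (f m / INR m))
        by (field; lra); exact Hc. }
    assert (f m / INR n < eps / 2); [|lra].
    apply Rlt_div_l; [exact HnR|].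
    apply (Rmult_lt_compat_r (eps / 2)) in HN; [|lra].
    replace (2 * f m / eps * (eps / 2)) with (f m) in HN by (field; lra).
    assert (INR N <= INR n) by (apply le_INR; lia); nra.
  - intros [|n].
    (* The supremum says nothing at 0, but the linear bound gives [f 0 <= 0]. *)
    + specialize (HC 0%nat); simpl in *; lra.
    + apply Rle_div_l; [apply lt_0_INR; lia|apply Hub; exists (S n); split; [lia|reflexivity]].
Qed.

(** The square root is an error scale that vanishes after division by [n], yet absorbs both
    logarithms and constants. *)
Lemma limit_le_up_to_sqrt (f : nat -> R) (l l' C : R) :
  Un_cv (fun n => f n / INR n) l ->
  (forall n, (0 < n)%nat -> f n <= l' * INR n + C * sqrt (INR n)) -> l <= l'.
Proof.
  intros Hl Hf; apply Rnot_lt_le; intro Hlt.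
  destruct (Hl ((l - l') / 2)) as [N HN]; [lra|].
  (* Once [sqrt (INR n)] exceeds [K], the error is less than half of the gap [(l - l') * INR n]. *)
  set (K := 2 * Rabs C / (l - l')).
  destruct (INR_unbounded (K * K)) as [N' HN'].
  set (n := S (N + N')); specialize (HN n ltac:(unfold n; lia)).
  assert (Hn : 0 < INR n) by (apply lt_0_INR; unfold n; lia).
  assert (Hs : 0 < sqrt (INR n)) by now apply sqrt_lt_R0.
  assert (Hss : sqrt (INR n) * sqrt (INR n) = INR n) by (apply sqrt_sqrt; lra).
  unfold Rdist in HN; apply Rabs_def2 in HN; destruct HN as [_ HN].
  assert (HN1 : (l + l') / 2 * INR n < f n) by (apply Rlt_div_r; lra).
  specialize (Hf n ltac:(unfold n; lia)).
  assert (HK : K < sqrt (INR n)).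
  { apply Rnot_le_lt; intro; assert (INR N' <= INR n) by (apply le_INR; unfold n; lia); nra. }
  unfold K in HK; apply Rlt_div_l in HK; [|lra].
  pose proof (Rle_abs C); nra.
Qed.

(** Write ln x as 2 ln (sqrt x) and use 1 + y <= exp y at y = ln (sqrt x). *)
Lemma ln_le_sqrt x : 0 < x -> ln x <= 2 * sqrt x.
Proof.
  intro Hx; pose proof (sqrt_lt_R0 x Hx) as Hs.
  rewrite <- (sqrt_sqrt x) at 1 by lra; rewrite ln_mult by assumption.
  pose proof (exp_ineq1_le (ln (sqrt x))) as H; rewrite exp_ln in H by assumption; lra.
Qed.

Definition ln_nat (a : nat) : R := ln (INR a).

Lemma ln_nat_le a b : (0 < a)%nat -> (a <= b)%nat -> ln_nat a <= ln_nat b.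
Proof.
  intros Ha Hab; apply ln_le; [now apply lt_0_INR|now apply le_INR].
Qed.

Lemma ln_nat_nonneg a : (0 < a)%nat -> 0 <= ln_nat a.
Proof.
  intro Ha; replace 0 with (ln_nat 1) by apply ln_1; apply ln_nat_le; lia.
Qed.

Lemma ln_nat_mul a b : (0 < a)%nat -> (0 < b)%nat -> ln_nat (a * b) = ln_nat a + ln_nat b.
Proof.
  intros Ha Hb; unfold ln_nat; rewrite mult_INR; apply ln_mult; now apply lt_0_INR.
Qed.

Lemma ln_nat_pow a k : (0 < a)%nat -> ln_nat (a ^ k) = INR k * ln_nat a.
Proof.
  intro Ha; unfold ln_nat; rewrite pow_INR, ln_pow; [reflexivity|now apply lt_0_INR].
Qed.

Lemma supermultiplicative_rate (a : nat -> nat) :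
  (forall n, (0 < a n <= 16 ^ n)%nat) -> (forall n m, (a n * a m <= a (n + m))%nat) ->
  exists l, Un_cv (fun n => ln_nat (a n) / INR n) l /\ forall n, ln_nat (a n) <= l * INR n.
Proof.
  intros Ha Hm; apply (fekete _ (ln_nat 16)).
  - intro n; apply ln_nat_nonneg, Ha.
  - intro n; rewrite Rmult_comm, <- ln_nat_pow by lia; apply ln_nat_le; apply Ha.
  - intros n k; rewrite <- ln_nat_mul by apply Ha; apply ln_nat_le; [|apply Hm].
    pose proof (Ha n); pose proof (Ha k); nia.
Qed.

Lemma nth_root_limit (a : nat -> nat) l :
  Un_cv (fun n => ln_nat (a n) / INR n) l -> Un_cv (fun n => nth_root (a n) n) (exp l).
Proof.
  intro H; apply (continuity_seq exp) in H; [|apply derivable_continuous_pt, derivable_pt_exp].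
  intros eps Heps; destruct (H eps Heps) as [N HN]; exists N; intros n Hn.
  specialize (HN n Hn); unfold nth_root, Rpower; unfold ln_nat, Rdiv in HN.
  now rewrite Rmult_comm.
Qed.

(* Raising loops to the power [k] makes the cost of the wrapping negligible. *)
Lemma ln_loop_count_le l n M : (0 < n)%nat -> (0 < M)%nat ->
  (forall m, ln_nat (p_n m) <= l * INR m) ->
  (0 < count_walks (loop_walk M) (2 * n))%nat ->
  ln_nat (count_walks (loop_walk M) (2 * n)) <= l * INR n.
Proof.
  intros Hn HM Hp Hz; set (z := count_walks _ _) in *.
  apply Rnot_lt_le; intro Hlt.
  set (delta := ln_nat z - l * INR n); assert (Hd : 0 < delta) by (unfold delta; lra).
  (* With this [k] the excess [delta] per loop, accumulated over the copies, exceeds the wrapping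
     cost [l * INR (2 * M)]. Taking [S k] copies keeps the concatenation nonempty. *)
  destruct (INR_unbounded (l * INR (2 * M) / delta)) as [k Hk].
  assert (H : INR (S k) * ln_nat z <= l * INR (S k * n + 2 * M)).
  { rewrite <- ln_nat_pow by exact Hz; etransitivity; [|apply Hp].
    apply ln_nat_le; [apply Nat.neq_0_lt_0, Nat.pow_nonzero; lia|].
    etransitivity; [apply loop_count_pow|].
    replace (S k * (2 * n))%nat with (2 * (S k * n))%nat by ring.
    apply loop_count_le_p; nia. }
  rewrite plus_INR, mult_INR in H; apply Rlt_div_l in Hk; [|exact Hd].
  rewrite S_INR in H; unfold delta in *; nra.
Qed.

(** Half the logarithm of [b_n_square_le] bounds the left side by [l * INR n] plus the logarithm of
    the number 4n + 1 of endpoints. *)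
Lemma ln_b_le l n : (0 < n)%nat -> (forall m, ln_nat (p_n m) <= l * INR m) ->
  ln_nat (b_n n) <= l * INR n + 2 * sqrt 5 * sqrt (INR n).
Proof.
  intros Hn Hp; pose proof (b_n_square_le n) as H; pose proof (b_pos n) as Hb.
  set (z := count_walks _ _) in H.
  assert (Hz : (0 < z)%nat) by nia.
  apply ln_nat_le in H; [|nia]; rewrite !ln_nat_mul in H by nia.
  assert (Hzl : ln_nat z <= l * INR (2 * n)) by (apply ln_loop_count_le; auto; lia).
  rewrite mult_INR in Hzl; simpl INR in Hzl.
  (* The constant 5 comes from 4n + 1 <= 5n for positive [n]. *)
  assert (H5 : ln_nat (4 * n + 1) <= 2 * (sqrt 5 * sqrt (INR n))).
  { rewrite <- sqrt_mult by (try apply pos_INR; lra).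
    replace (5 * INR n) with (INR (5 * n)) by (rewrite mult_INR; simpl; lra).
    etransitivity; [apply (ln_nat_le _ (5 * n)); lia|].
    apply ln_le_sqrt, lt_0_INR; lia. }
  lra.
Qed.

Theorem theorem2p1 :
  exists mu : R,
    Un_cv (fun n => nth_root (p_n n) n) mu /\
    Un_cv (fun n => nth_root (d_n n) n) mu /\
    Un_cv (fun n => nth_root (b_n n) n) mu.
Proof.
  destruct (supermultiplicative_rate b_n) as (lb & Hb & Hb'); [|exact b_mul|].
  { intro n; split; [apply b_pos|apply b_le_pow]. }
  destruct (supermultiplicative_rate d_n) as (ld & Hd & Hd'); [|exact d_mul|].
  { intro n; split; [apply d_pos|etransitivity; [apply d_le_b|apply b_le_pow]]. }
  destruct (supermultiplicative_rate p_n) as (lp & Hp & Hp'); [|exact p_mul|].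
  { intro n; split; [apply p_pos|etransitivity; [apply p_le_b|apply b_le_pow]]. }
  assert (ld_nonneg : 0 <= ld).
  { specialize (Hd' 1%nat); pose proof (ln_nat_nonneg _ (d_pos 1)); simpl INR in Hd'; lra. }
  assert (Hdb : ld <= lb).
  { apply (limit_le_up_to_sqrt _ _ _ 0 Hd); intros n _.
    pose proof (ln_nat_le _ _ (d_pos n) (d_le_b n)); specialize (Hb' n); lra. }
  assert (Hpb : lp <= lb).
  { apply (limit_le_up_to_sqrt _ _ _ 0 Hp); intros n _.
    pose proof (ln_nat_le _ _ (p_pos n) (p_le_b n)); specialize (Hb' n); lra. }
  assert (Hbp : lb <= lp).
  { apply (limit_le_up_to_sqrt _ _ _ (2 * sqrt 5) Hb); intros n Hn; now apply ln_b_le. }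
  assert (Hbd : lb <= ld).
  { apply (limit_le_up_to_sqrt _ _ _ (2 * ld) Hb); intros n Hn.
    pose proof (ln_nat_le _ _ (b_pos n) (b_le_d n)) as H; specialize (Hd' (n + 2)%nat).
    rewrite plus_INR in Hd'; simpl (INR 2) in Hd'.
    assert (1 <= sqrt (INR n)).
    { rewrite <- sqrt_1; apply sqrt_le_1_alt; apply (le_INR 1); lia. }
    nra. }
  replace ld with lb in Hd by lra; replace lp with lb in Hp by lra.
  exists (exp lb); repeat split; now apply nth_root_limit.
Qed.
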